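(* Let $\vec G=(V,\vec E)$ be a finite directed graph with no self-edges and no multiple edges whose associated undirected graph $G=(V,E)$ is connected, let $A\in\mathbb{R}^{V\times\vec E}$ be its vertex-edge incidence matrix, and for each $e\in\vec E$ let $f_e:\mathbb{R}\to\mathbb{R}$ be strongly convex and twice continuously differentiable. Let $x^\star(b)$, $W(b)$, $d(b)$, $\lambda$ and $\nabla_e x^\star(b)$ be as defined in the context, and assume $\lambda<1$. Then for every $b\in\mathbb{R}^V$ with $\mathbb{1}^Tb=0$, every nonempty $\vec F\subseteq\vec E$ and every $f=(w,z)\in\vec E$, $$\sqrt{\sum_{e\in\vec F}(\nabla_e x^\star(b)_f)^2}\le\sqrt2\,c'\,\frac{\lambda^{d(V_{\vec F},V_{\{f\}})}}{1-\lambda},$$ where $$c':=\sup_{b\in\operatorname{Im}(A)}\frac{W(b)_{wz}\,\max_{v\in V_{\vec F}}\sqrt{2\,|\mathcal{N}(v)\cap V_{\vec F}|}}{\sqrt{\min\{d(b)_w,d(b)_z\}}\ \min_{v\in V_{\vec F}}\sqrt{d(b)_v}}.$$ (If $c'=+\infty$ the inequality is vacuous.)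
   Context: The undirected graph $G=(V,E)$ associated with $\vec G$ has $\{u,v\}\in E$ iff $(u,v)\in\vec E$ or $(v,u)\in\vec E$; ''no multiple edges'' means in particular that at most one of $(u,v),(v,u)$ belongs to $\vec E$. The incidence matrix is $A_{ve}:=1$ if $e$ leaves $v$, $-1$ if $e$ enters $v$, $0$ otherwise; $\mathbb{1}$ is the all-ones vector and $\operatorname{Im}(A)=\{y\in\mathbb{R}^V:\mathbb{1}^Ty=0\}$. The optimal network flow is $x^\star(b):=\operatorname{argmin}\{\sum_{e\in\vec E}f_e(x_e):x\in\mathbb{R}^{\vec E},\ Ax=b\}$ (unique); it is $C^1$ as a map on $\operatorname{Im}(A)$. For $e=(u,v)\in\vec E$, $\nabla_e x^\star(b):=\frac{d}{d\varepsilon}x^\star(b+\varepsilon(e_u-e_v))|_{\varepsilon=0}\in\mathbb{R}^{\vec E}$, where $e_v\in\mathbb{R}^V$ is the standard basis vector at $v$; $\nabla_e x^\star(b)_f$ is its $f$-component. For $b\in\operatorname{Im}(A)$: $W(b)\in\mathbb{R}^{V\times V}$ is symmetric with $W(b)_{uv}:=(f_e''(x^\star(b)_e))^{-1}$ if $e=(u,v)\in\vec E$ or $e=(v,u)\in\vec E$, and $0$ otherwise; $d(b)_v:=\sum_{u\in V}W(b)_{vu}$; $P(b):=\operatorname{diag}(d(b))^{-1}W(b)$. With $n:=|V|$, let $-1\le\lambda_n(b)\le\cdots\le\lambda_2(b)<\lambda_1(b)=1$ be the (real) eigenvalues of $P(b)$, $\lambda(b):=\max\{|\lambda_2(b)|,|\lambda_n(b)|\}$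 and $\lambda:=\sup_{b\in\operatorname{Im}(A)}\lambda(b)$. $\mathcal{N}(v):=\{w\in V:\{v,w\}\in E\}$. $d(u,v)$ (two vertex arguments) is the unweighted shortest-path distance in $G$, and $d(U,Z):=\min\{d(u,z):u\in U,z\in Z\}$ for $U,Z\subseteq V$. For $\vec F\subseteq\vec E$, $V_{\vec F}\subseteq V$ is the set of endpoints of edges in $\vec F$. *)

(* Defs.v *)
(* MathComp / MathComp-Analysis *)
From HB Require Import structures.
From mathcomp Require Import all_boot all_order all_algebra.
From mathcomp Require Import all_classical all_reals all_analysis.

Set Implicit Arguments.
Unset Strict Implicit.
Unset Printing Implicit Defensive.

Import Order.TTheory GRing.Theory Num.Theory.
Import numFieldNormedType.Exports.

Local Open Scope classical_set_scope.
Local Open Scope ring_scope.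

(* The vertices are 'I_n and the edges are 'I_m; the edge e is the ordered pair
   (src e, dst e). *)
Record digraph (n m : nat) := Digraph {
  src : 'I_m -> 'I_n;
  dst : 'I_m -> 'I_n;
  no_self_edge : forall e, src e != dst e;
  no_parallel : forall e e', src e = src e' -> dst e = dst e' -> e = e';
  no_antiparallel : forall e e', ~ (src e = dst e' /\ dst e = src e') }.

Section Graph.
Variables (n m : nat) (G : digraph n m).

Definition joins (e : 'I_m) (u v : 'I_n) : bool :=
  (src G e == u) && (dst G e == v) || (src G e == v) && (dst G e == u).

Definition adj : rel 'I_n := fun u v => [exists e, joins e u v].

Definition connected_graph : Prop := forall u v, connect adj u v.

Definition neighbors (v : 'I_n) : {set 'I_n} := [set w | adj v w].

Definition walk (k : nat) (u v : 'I_n) : bool :=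
  [exists p : k.-tuple 'I_n, path adj u p && (last u p == v)].

(* A shortest path has fewer than n edges; the value n stands for "no path". *)
Definition dist (u v : 'I_n) : nat := \big[minn/n]_(k < n | walk k u v) k.

(* Distances between vertices are at most n, so for nonempty U and Z the
   neutral element n does not affect the minimum. *)
Definition set_dist (U Z : {set 'I_n}) : nat :=
  \big[minn/n]_(u in U) \big[minn/n]_(z in Z) dist u z.

Definition endpoints (F : {set 'I_m}) : {set 'I_n} :=
  [set v | [exists e in F, (v == src G e) || (v == dst G e)]].

End Graph.

Section Eigenvalues.
Variable R : realType.

(* The eigenvalues of M with multiplicity in nonincreasing order, provided that
   char_poly M splits over R ([::] otherwise). *)
Definition eigenvalues (n : nat) (M : 'M[R]_n) : seq R :=
  xget [::] [set s | sorted >=%R s /\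
                     char_poly M = \prod_(a <- s) ('X - a%:P)].

(* The minimum of g over A, for nonempty A. *)
Definition min_over (n : nat) (A : {set 'I_n}) (g : 'I_n -> R) : R :=
  if [pick v in A] is Some v0 then \big[Num.min/g v0]_(v in A) g v else 0.

End Eigenvalues.

Section Flow.
Variables (R : realType) (n m : nat) (G : digraph n m).
Variable f : 'I_m -> R -> R.

Definition strongly_convex (g : R -> R) : Prop :=
  exists2 mu : R, 0 < mu & forall x y t : R, 0 <= t <= 1 ->
    g (t * x + (1 - t) * y) <=
      t * g x + (1 - t) * g y - mu / 2 * t * (1 - t) * (x - y) ^+ 2.

Definition twice_continuously_differentiable (g : R -> R) : Prop :=
  [/\ forall x : R, derivable g x 1,
      forall x : R, derivable (g^`()%classic) x 1 &
      continuous (g^`(2)%classic)].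

Definition incidence : 'M[R]_(n, m) :=
  \matrix_(v, e) if v == src G e then 1 else if v == dst G e then -1 else 0.

Definition im_incidence : set 'cV[R]_n :=
  range (fun x : 'cV[R]_m => incidence *m x).

Definition total_cost (x : 'cV[R]_m) : R := \sum_e f e (x e 0).

Definition is_opt_flow (b : 'cV[R]_n) (x : 'cV[R]_m) : Prop :=
  incidence *m x = b /\
  forall y : 'cV[R]_m, incidence *m y = b -> total_cost x <= total_cost y.

Definition opt_flow (b : 'cV[R]_n) : 'cV[R]_m := xget 0 [set x | is_opt_flow b x].

Definition basis_vec (v : 'I_n) : 'cV[R]_n := delta_mx v 0.

Definition nabla (e : 'I_m) (b : 'cV[R]_n) : 'cV[R]_m :=
  (fun eps : R =>
     opt_flow (b + eps *: (basis_vec (src G e) - basis_vec (dst G e))))^`()%classic 0.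

(* At most one edge joins u and v. *)
Definition weight (b : 'cV[R]_n) : 'M[R]_n :=
  \matrix_(u, v) if [pick e | joins G e u v] is Some e
                 then ((f e)^`(2)%classic (opt_flow b e 0))^-1 else 0.

Definition wdeg (b : 'cV[R]_n) : 'rV[R]_n := \row_v \sum_u weight b v u.

Definition transition (b : 'cV[R]_n) : 'M[R]_n :=
  invmx (diag_mx (wdeg b)) *m weight b.

(* Indices are shifted by one: lambda_2 is the entry of index 1, and lambda_n
   the entry of index n.-1. *)
Definition lambda_at (b : 'cV[R]_n) : R :=
  let s := eigenvalues (transition b) in Num.max `|s`_1| `|s`_n.-1|.

(* The eigenvalues of a stochastic matrix lie in [-1, 1], so that this is the
   supremum of a nonempty bounded set. *)
Definition lambda : R := sup [set lambda_at b | b in im_incidence].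

Definition c_at (F : {set 'I_m}) (e : 'I_m) (b : 'cV[R]_n) : R :=
  let VF := endpoints G F in
  let w := src G e in let z := dst G e in
  weight b w z *
    (\big[Num.max/0]_(v in VF) Num.sqrt (2 * #|neighbors G v :&: VF|%:R)) /
  (Num.sqrt (Num.min (wdeg b 0 w) (wdeg b 0 z)) *
     min_over VF (fun v => Num.sqrt (wdeg b 0 v))).

Definition c_prime (F : {set 'I_m}) (e : 'I_m) : \bar R :=
  ereal_sup [set (c_at F e b)%:E | b in im_incidence].

End Flow.

(* Main.v *)
Require Import Defs.
From HB Require Import structures.
From mathcomp Require Import all_boot all_order all_algebra.
From mathcomp Require Import all_classical all_reals all_analysis.
From mathcomp Require Import complex ring lra.

(* Write W = W(b), d = d(b), L = diag(d) - W (the Laplacian) and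
   S = diag(d)^(-1/2) W diag(d)^(-1/2).  Differentiating the stationarity
   conditions gives nabla_e x*(b)_f = W_wz <e_w - e_z, phi> with L phi = e_u - e_v
   for e = (u, v), and by symmetry of L this is W_wz (psi_u - psi_v) where
   L psi = e_w - e_z does not depend on e.  Setting y = diag(d)^(1/2) psi and
   q = diag(d)^(-1/2) (e_w - e_z) turns the equation into (1 - S) y = q, so that
   y = q + S q + ... + S^(k-1) q + S^k y for every k.  For k the distance
   d(V_F, {w, z}), the first k terms vanish on V_F.  On the orthogonal complement
   of the Perron vector diag(d)^(1/2) 1, which contains q and y, S contracts the
   Euclidean norm by lambda(b); hence |S^k y| <= lambda(b)^k |y| and
   (1 - lambda(b)) |y| <= |q|. *)

Set Implicit Arguments.
Unset Strict Implicit.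
Unset Printing Implicit Defensive.

Import Order.TTheory GRing.Theory Num.Theory.
Import numFieldNormedType.Exports.

Local Open Scope ring_scope.

(** * Spectral bounds for reversible chains *)

Section Spectral.
Local Open Scope complex_scope.
Local Open Scope sesquilinear_scope.
Variable R : rcfType.

Lemma char_poly_conj (K : comNzRingType) n (T T' A : 'M[K]_n) :
  T *m T' = 1%:M -> char_poly (T *m A *m T') = char_poly A.
Proof.
move=> TT'; rewrite /char_poly /char_poly_mx.
have TT'X : map_mx polyC T *m map_mx polyC T' = 1%:M.
  by rewrite -map_mxM TT' map_mx1.
have -> : 'X%:M - map_mx polyC (T *m A *m T') =
    map_mx polyC T *m ('X%:M - map_mx polyC A) *m map_mx polyC T'.
  by rewrite mulmxBr mulmxBl !map_mxM scalar_mxC -['X%:M *m _ *m _]mulmxA TT'X mulmx1.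
by rewrite !det_mulmx mulrAC -det_mulmx TT'X det1 mul1r.
Qed.

(** The image of [A] over [R[i]] is Hermitian, so its spectral diagonal is real and descends to
    [lam] over [R]. The eigenbasis may stay complex, since only squared norms are compared later. *)
Lemma symmetric_diagonalizable n (A : 'M[R]_n) : A^T = A ->
  exists (U : 'M[R[i]]_n) (lam : 'rV[R]_n), U \is unitarymx /\
    map_mx (real_complex R) A =
      U^t* *m diag_mx (map_mx (real_complex R) lam) *m U.
Proof.
move=> symA; set A' := map_mx _ A.
have A'h : A' \is hermsymmx.
  apply: realsym_hermsym.
    by apply/is_hermitianmxP; rewrite expr0 scale1r map_mx_id// map_trmx symA.
  by apply/mxOverP => i j; rewrite mxE; apply/complex_realP; exists (A i j).
have /mxOverP spR := hermitian_spectral_diag_real A'h.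
have /hermitian_normalmx /orthomx_spectralP := A'h.
rewrite invmx_unitary ?spectral_unitarymx// => {1}->.
exists (spectralmx A'), (map_mx (@complex.Re R) (spectral_diag A')).
split; first exact: spectral_unitarymx.
by congr (_ *m diag_mx _ *m _); apply/rowP => i; rewrite !mxE RRe_real.
Qed.

Lemma char_poly_diagonalized n (A : 'M[R]_n) (U : 'M[R[i]]_n) (lam : 'rV[R]_n) :
  U \is unitarymx ->
  map_mx (real_complex R) A =
    U^t* *m diag_mx (map_mx (real_complex R) lam) *m U ->
  char_poly A = \prod_(i < n) ('X - (lam 0 i)%:P).
Proof.
move=> Uu AE; apply: (map_poly_inj (real_complex R)).
rewrite map_char_poly AE char_poly_conj; last first.
  by have /unitarymxP/mulmx1C := Uu.
rewrite char_poly_trig ?diag_mx_is_trig// rmorph_prod; apply: eq_bigr => i _.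
by rewrite !mxE eqxx mulr1n rmorphB/= map_polyX map_polyC.
Qed.

(* The eigenvector [s] spans the eigenspace of the simple eigenvalue 1, so only
   the eigenvalues in [t] act on its orthogonal complement. *)
Lemma symmetric_contraction n (A : 'M[R]_n) (s : 'cV[R]_n) (t : seq R) (r : R) :
  A^T = A -> s != 0 -> A *m s = s ->
  char_poly A = \prod_(a <- 1 :: t) ('X - a%:P) ->
  (forall a, a \in t -> `|a| <= r) -> r < 1 ->
  forall x : 'cV[R]_n, \sum_i s i 0 * x i 0 = 0 ->
  \sum_i (A *m x) i 0 ^+ 2 <= r ^+ 2 * \sum_i x i 0 ^+ 2.
Proof.
move=> symA s0 As cpA tr r1 x sx.
have [U [lam [Uu AE]]] := symmetric_diagonalizable symA.
have UU : U^t* *m U = 1%:M by have /unitarymxP/mulmx1C := Uu.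
have UU' : U *m U^t* = 1%:M by have /unitarymxP := Uu.
(* Coordinates in the eigenbasis: [A] acts on them diagonally ([cA]), and unitarity preserves inner
   products ([cdot]). *)
pose c (y : 'cV[R]_n) := U *m map_mx (real_complex R) y.
have cA y i : c (A *m y) i 0 = (lam 0 i)%:C * c y i 0.
  rewrite /c map_mxM AE -!mulmxA mulmxA UU' mul1mx mul_diag_mx.
  by rewrite !mxE.
have cdot (y z : 'cV[R]_n) :
    (\sum_i y i 0 * z i 0)%:C = \sum_i (c y i 0)^*%R * c z i 0.
  have : (map_mx (real_complex R) y)^t* *m map_mx (real_complex R) z
         = (c y)^t* *m c z.
    by rewrite /c trmx_mul map_mxM !mulmxA -[_ *m U^t* *m U]mulmxA UU mulmx1.
  move=> /matrixP/(_ 0 0); rewrite !mxE rmorph_sum/= => H.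
  transitivity (\sum_j ((map_mx (real_complex R) y) ^t*) 0 j * map_mx (real_complex R) z j 0).
    apply: eq_bigr => i _; rewrite !mxE rmorphM/=; congr (_ * _).
    by apply/esym/conj_Creal; apply/complex_realP; exists (y i 0).
  by rewrite H; apply: eq_bigr => i _; rewrite !mxE.
have cnorm (y : 'cV[R]_n) :
    (\sum_i y i 0 ^+ 2)%:C = \sum_i `|c y i 0| ^+ 2.
  under eq_bigr do rewrite expr2.
  by rewrite cdot; apply: eq_bigr => i _; rewrite normCKC.
have perm : perm_eq (1 :: t) [seq lam 0 i | i <- enum 'I_n].
  apply: prod_XsubC_eq; rewrite -cpA (char_poly_diagonalized Uu AE).
  by rewrite big_map big_enum.
have /mapP[i0 _ lam0] : 1 \in [seq lam 0 i | i <- enum 'I_n].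
  by rewrite -(perm_mem perm) mem_head.
(* Deleting one index with eigenvalue 1 removes a single 1 from the spectrum, so all other indices
   carry eigenvalues from [t]. *)
have permt : perm_eq t [seq lam 0 i | i <- rem i0 (enum 'I_n)].
  rewrite -(perm_cons 1); apply: (perm_trans perm).
  by rewrite lam0 -map_cons perm_map// perm_to_rem// mem_enum.
have lam_le i : i != i0 -> `|lam 0 i| <= r.
  move=> ii0; apply: tr; rewrite (perm_mem permt) map_f//.
  by rewrite rem_filter ?enum_uniq// mem_filter/= ii0 mem_enum.
(* In coordinates [A *m s = s] reads lam_i c_i = c_i, where lam_i differs from 1. So [s] lives on
   [i0] alone, and orthogonality to [s] is the vanishing of coordinate [i0]. *)
have s_i i : i != i0 -> c s i 0 = 0.
  move=> /lam_le lami; have := cA s i; rewrite As => /eqP.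
  rewrite -{1}[c s i 0]mul1r -subr_eq0 -mulrBl mulf_eq0 => /orP[|/eqP//].
  rewrite -(rmorph1 (real_complex R)) -rmorphB/= fmorph_eq0 subr_eq0 => /eqP l1.
  by move: lami; rewrite -l1 normr1 leNgt r1.
have s_i0 : c s i0 0 != 0.
  apply: contra_neq s0 => s_i0.
  have : c s = 0.
    apply/colP => i; rewrite [RHS]mxE; have [->//|] := eqVneq i i0.
    exact: s_i.
  move=> /(congr1 (mulmx (U^t*))); rewrite mulmx0 /c mulmxA UU mul1mx => /eqP.
  by rewrite map_mx_eq0 => /eqP.
have x_i0 : c x i0 0 = 0.
  have := cdot s x; rewrite sx rmorph0 (bigD1 i0)//= big1 ?addr0; last first.
    by move=> i /s_i ->; rewrite rmorph0 mul0r.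
  move=> /esym/eqP; rewrite mulf_eq0 conjC_eq0 (negbTE s_i0)/=.
  by move=> /eqP.
rewrite -lecR rmorphM/= !cnorm mulr_sumr ler_sum// => i _.
rewrite cA normrM exprMn; have [->|ii0] := eqVneq i i0.
  by rewrite x_i0 normr0 expr0n/= !mulr0.
rewrite ler_wpM2r ?exprn_ge0// normc_def/= expr0n addr0 sqrtr_sqr.
rewrite -rmorphXn/= lecR lerXn2r ?nnegrE ?(le_trans _ (lam_le _ ii0))//.
Qed.

End Spectral.

(* The reverse triangle inequality, squared to avoid norms. *)
Lemma sum_sqr_sub_ge (R : realFieldType) n (r : R) (y z : 'cV[R]_n) : 0 <=
  r < 1 ->
  \sum_i z i 0 ^+ 2 <= r ^+ 2 * \sum_i y i 0 ^+ 2 ->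
  (1 - r) ^+ 2 * \sum_i y i 0 ^+ 2 <= \sum_i (y - z) i 0 ^+ 2.
Proof.
move=> /andP[r0 r1] zy; move: r0; rewrite le_eqVlt => /orP[/eqP r0|r0].
  have z0 i : z i 0 = 0.
    have : \sum_i z i 0 ^+ 2 == 0.
      rewrite eq_le sumr_ge0 ?andbT; last by move=> j _; rewrite sqr_ge0.
      by rewrite (le_trans zy)// -r0 expr0n/= mul0r.
    rewrite psumr_eq0 => [/allP/(_ i (mem_index_enum _))|j _];
      last by rewrite sqr_ge0.
    by rewrite /= sqrf_eq0 => /eqP.
  rewrite -r0 subr0 expr1n mul1r ler_sum// => i _.
  by rewrite !mxE z0 subr0.
(* This is Young's inequality 2yz <= r y^2 + z^2 / r, multiplied by [r] to avoid the division; hence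
   the separate case r = 0 above. *)
rewrite -(ler_pM2l r0) -subr_ge0.
have -> : r * (\sum_i (y - z) i 0 ^+ 2) - r * ((1 - r) ^+ 2 * (\sum_i y i 0 ^+ 2)) =
   \sum_i (r * y i 0 - z i 0) ^+ 2 +
   (1 - r) * (r ^+ 2 * (\sum_i y i 0 ^+ 2) - \sum_i z i 0 ^+ 2).
  rewrite !mulr_sumr -!sumrB mulr_sumr -big_split/=; apply: eq_bigr => i _.
  by rewrite !mxE; ring.
rewrite addr_ge0//; first by apply: sumr_ge0 => i _; rewrite sqr_ge0.
by rewrite mulr_ge0// subr_ge0// ltW.
Qed.

(** * Reversible Markov chains and their symmetrization *)

Section ReversibleChain.
Variables (R : realType) (n : nat) (W : 'M[R]_n) (d : 'rV[R]_n).
Hypothesis Wsym : forall u v, W u v = W v u.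
Hypothesis W_ge0 : forall u v, 0 <= W u v.
Hypothesis dE : forall v, d 0 v = \sum_u W v u.
Hypothesis d_gt0 : forall v, 0 < d 0 v.

Local Notation P := (invmx (diag_mx d) *m W).
Definition sqrt_deg : 'cV[R]_n := \col_v Num.sqrt (d 0 v).
Local Notation rd := sqrt_deg.
Definition normalized_adj : 'M[R]_n :=
  \matrix_(i, j) (W i j / (rd i 0 * rd j 0)).
Local Notation S := normalized_adj.

Let rd_gt0 v : 0 < rd v 0.
Proof. by rewrite mxE sqrtr_gt0. Qed.

Let rd_neq0 v : rd v 0 != 0.
Proof. by rewrite gt_eqF// rd_gt0. Qed.

Let sqr_rd v : rd v 0 ^+ 2 = d 0 v.
Proof. by rewrite mxE sqr_sqrtr// ltW. Qed.

Lemma invmx_diag : invmx (diag_mx d) = diag_mx (\row_v (d 0 v)^-1).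
Proof.
have dd : diag_mx d *m diag_mx (\row_v (d 0 v)^-1) = 1%:M.
  rewrite mulmx_diag -diag_const_mx; congr diag_mx.
  by apply/rowP => v; rewrite !mxE mulfV// gt_eqF.
have [du _] := mulmx1_unit dd.
by rewrite -[LHS]mulmx1 -dd mulKmx.
Qed.

Lemma transitionE i j : P i j = W i j / d 0 i.
Proof. by rewrite invmx_diag mul_diag_mx !mxE mulrC. Qed.

(** [P] is diag(rd)^-1 S diag(rd), so the spectrum of [P] can be read off the symmetric matrix
    [S]. *)
Lemma char_poly_normalized_adj : char_poly P = char_poly S.
Proof.
rewrite -(@char_poly_conj _ _ (diag_mx (\row_v (rd v 0)^-1)) (diag_mx rd^T) S); last first.
  rewrite mulmx_diag -diag_const_mx; congr diag_mx.
  by apply/rowP => v; have := rd_neq0 v; rewrite !mxE => /mulVf.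
congr char_poly; apply/matrixP => i j.
rewrite transitionE mul_mx_diag mul_diag_mx !mxE -[X in _ / X = _]sqr_rd mxE.
have := rd_neq0 i; have := rd_neq0 j; rewrite !mxE => j0 i0.
by field; rewrite i0 j0.
Qed.

Lemma normalized_adj_sym : S^T = S.
Proof. by apply/matrixP => i j;
  rewrite [LHS]mxE [LHS]mxE [RHS]mxE Wsym (mulrC (rd j 0)). Qed.

Lemma normalized_adj_fixed : S *m rd = rd.
Proof.
apply/colP => i; rewrite mxE.
under eq_bigr => j _.
  rewrite mxE; have -> : W i j / (rd i 0 * rd j 0) * rd j 0 = W i j / rd i 0.
    by field; rewrite !rd_neq0.
  over.
by rewrite -mulr_suml -dE -sqr_rd expr2 mulfK.
Qed.

(** [eigenvalues] selects a list by [xget], so a valid list must be exhibited: the sorted spectral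
    diagonal of [S]. *)
Lemma eigenvalues_transition :
  sorted >=%R (eigenvalues P) /\
  char_poly P = \prod_(a <- eigenvalues P) ('X - a%:P).
Proof.
have [U [lam [Uu SE]]] := symmetric_diagonalizable normalized_adj_sym.
have cpS := char_poly_diagonalized Uu SE.
pose s := sort >=%R [seq lam 0 i | i <- enum 'I_n].
have sP : sorted >=%R s /\ char_poly P = \prod_(a <- s) ('X - a%:P).
  split; first by apply: sort_sorted => x y; exact: le_total.
  rewrite char_poly_normalized_adj cpS (perm_big _ (permEl (perm_sort _ _))).
  by rewrite big_map big_enum.
exact: (@xgetPex _ [::] [set s | sorted >=%R s /\
                     char_poly P = \prod_(a <- s) ('X - a%:P)]%classic
          (ex_intro _ s sP)).
Qed.

Lemma size_eigenvalues : size (eigenvalues P) = n.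
Proof.
have [_ cp] := eigenvalues_transition.
by have := size_char_poly P; rewrite cp size_prod_XsubC => -[].
Qed.

Lemma mem_eigenvalues a : a \in eigenvalues P = root (char_poly P) a.
Proof. by have [_ ->] := eigenvalues_transition; rewrite root_prod_XsubC. Qed.

(** The rows of [P] are nonnegative with sum 1, so v -> vP does not increase the l1 norm; apply this
    to a left eigenvector. *)
Lemma eigenvalue_le1 a : a \in eigenvalues P -> `|a| <= 1.
Proof.
rewrite mem_eigenvalues -eigenvalue_root_char => /eigenvalueP[v vP v0].
have P_ge0 i j : 0 <= P i j by rewrite transitionE divr_ge0// ltW.
have P_sum i : \sum_j P i j = 1.
  under eq_bigr do rewrite transitionE.
  by rewrite -mulr_suml -dE mulfV// gt_eqF.
have v_gt0 : 0 < \sum_i `|v 0 i|.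
  rewrite lt_def sumr_ge0// andbT psumr_neq0//.
  have /eqP/rowP/existsNP[i /eqP vi] := v0; rewrite mxE in vi.
  by apply/hasP; exists i; rewrite ?mem_index_enum//= normr_gt0.
rewrite -(ler_pM2r v_gt0) mul1r mulr_sumr.
rewrite [leRHS](_ : _ = \sum_j \sum_i `|v 0 i| * P i j); last first.
  rewrite exchange_big/=; apply: eq_bigr => i _.
  by rewrite -mulr_sumr P_sum mulr1.
apply: ler_sum => j _; rewrite -normrM.
have -> : a * v 0 j = (v *m P) 0 j by rewrite vP mxE.
rewrite mxE (le_trans (ler_norm_sum _ _ _))// ler_sum// => i _.
by rewrite normrM (ger0_norm (P_ge0 _ _)).
Qed.

(** For the weights of a flow network this is convertible to [lambda_at]. *)
Definition second_eigenvalue : R :=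
  Num.max `|(eigenvalues P)`_1| `|(eigenvalues P)`_n.-1|.
Local Notation lam := second_eigenvalue.

Lemma second_eigenvalue_ge0 : 0 <= lam.
Proof. by rewrite le_max normr_ge0. Qed.

Hypothesis n_gt1 : (1 < n)%N.

Lemma second_eigenvalue_le1 : lam <= 1.
Proof.
by rewrite ge_max !eigenvalue_le1// mem_nth// size_eigenvalues// prednK// ltnW.
Qed.

Hypothesis lam_lt1 : lam < 1.

(** By sortedness every entry of the tail lies between the tail's first and last entries, whose
    moduli are at most [lam]. As [lam] < 1, the eigenvalue 1 of [rd] can only be the head. *)
Lemma eigenvalues_split : exists2 t, eigenvalues P = 1 :: t &
  forall a, a \in t -> `|a| <= lam.
Proof.
have [srt _] := eigenvalues_transition.
have s1 : 1 \in eigenvalues P.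
  rewrite mem_eigenvalues char_poly_normalized_adj -eigenvalue_root_char.
  apply/eigenvalueP; exists rd^T.
    by rewrite scale1r -[S]normalized_adj_sym -trmx_mul normalized_adj_fixed.
  have i0 : 'I_n by exact: (Ordinal (ltnW n_gt1)).
  by apply/eqP => /rowP/(_ i0); rewrite mxE [RHS]mxE => /eqP;
    rewrite (negbTE (rd_neq0 _)).
have := size_eigenvalues; have := eigenvalue_le1; move: lam_lt1 srt s1.
rewrite /second_eigenvalue; case: (eigenvalues P) => // a t.
move=> l1 srt at1 a_le1 szn.
have tr : transitive (fun x y : R => x >= y) by move=> y x z /= xy yz;
  exact: le_trans yz xy.
have t_le i : (i < size t)%N -> t`_i <= t`_0 /\ t`_(size t).-1 <= t`_i.
  move=> it; have st : sorted >=%R t by exact: (path_sorted srt).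
  have nonempty : (0 < size t)%N by apply: leq_ltn_trans it.
  split; apply: (sorted_leq_nth tr _ 0 st) => //=; rewrite ?inE ?prednK//.
  by rewrite -ltnS prednK.
have t_lam b : b \in t -> `|b| <= Num.max `|(a :: t)`_1| `|(a :: t)`_n.-1|.
  move=> /(nthP 0)[i it <-]; have [le0 ge0] := t_le _ it.
  have nonempty : (0 < size t)%N by apply: leq_ltn_trans it.
  (* Index [n.-1] of the full list is the last index of the tail, which is nonempty. *)
  have -> : (a :: t)`_n.-1 = t`_(size t).-1.
    by rewrite -szn /= -{1}(prednK nonempty).
  rewrite /= ler_norml; apply/andP; split.
    rewrite (le_trans _ ge0)// lerNl le_max; apply/orP; right.
    by rewrite -normrN ler_norm.
  by rewrite (le_trans le0)// le_max ler_norm.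
have a1 : a = 1.
  move: at1; rewrite inE => /orP[/eqP//|/t_lam].
  by rewrite normr1 leNgt l1.
by exists t; [rewrite a1|exact: t_lam].
Qed.

Lemma normalized_adj_contraction (x : 'cV[R]_n) : \sum_i rd i 0 * x i 0 = 0 ->
  \sum_i (S *m x) i 0 ^+ 2 <= lam ^+ 2 * \sum_i x i 0 ^+ 2.
Proof.
have [t et tlam] := eigenvalues_split.
apply: (@symmetric_contraction _ _ _ _ t) => //.
- exact: normalized_adj_sym.
- have i0 : 'I_n by exact: (Ordinal (ltnW n_gt1)).
  by apply/eqP => /colP/(_ i0); rewrite [RHS]mxE => /eqP;
    rewrite (negbTE (rd_neq0 _)).
- exact: normalized_adj_fixed.
- by rewrite -char_poly_normalized_adj -et; have [] := eigenvalues_transition.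
Qed.

Let sdot_S (x : 'cV[R]_n) : \sum_i rd i 0 * (S *m x) i 0 =
  \sum_i rd i 0 * x i 0.
Proof.
have dotE (z : 'cV[R]_n) : \sum_i rd i 0 * z i 0 = (rd^T *m z) 0 0.
  by rewrite mxE; apply: eq_bigr => i _; rewrite !mxE.
rewrite !dotE mulmxA -[S]normalized_adj_sym -trmx_mul.
by rewrite normalized_adj_fixed.
Qed.

Lemma normalized_resolvent (q : 'cV[R]_n) : \sum_i rd i 0 * q i 0 = 0 ->
  exists2 y : 'cV[R]_n, \sum_i rd i 0 * y i 0 = 0 & y - S *m y = q.
Proof.
move=> sq.
have dotE (z : 'cV[R]_n) : rd^T *m z = (\sum_i rd i 0 * z i 0)%:M.
  rewrite [LHS]mx11_scalar; congr (_%:M).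
  by rewrite mxE; apply: eq_bigr => i _; rewrite !mxE.
(* 1 - S is singular exactly along [rd]. The rank-one term repairs this and vanishes on the
   complement of [rd], so inverting [M] solves the equation there. *)
pose M := 1%:M - S + rd *m rd^T.
have ME (x : 'cV[R]_n) : M *m x = x - S *m x + (\sum_i rd i 0 * x i 0) *: rd.
  by rewrite mulmxDl mulmxBl mul1mx -mulmxA dotE mul_mx_scalar.
have ss0 : \sum_i rd i 0 * rd i 0 != 0.
  have i0 : 'I_n by exact: (Ordinal (ltnW n_gt1)).
  rewrite psumr_neq0; last by move=> i _; rewrite mulr_ge0// ltW// rd_gt0.
  by apply/hasP; exists i0; rewrite ?mem_index_enum//= mulr_gt0// rd_gt0.
(* [M] multiplies the component along [rd] by |rd|^2. This keeps the solution orthogonal to [rd] and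
   forces kernel vectors to be orthogonal to it as well. *)
have MsE (x : 'cV[R]_n) : \sum_i rd i 0 * (M *m x) i 0 =
    (\sum_i rd i 0 * x i 0) * \sum_i rd i 0 * rd i 0.
  transitivity (\sum_i (rd i 0 * x i 0 - rd i 0 * (S *m x) i 0 +
     (\sum_i rd i 0 * x i 0) * (rd i 0 * rd i 0))).
    apply: eq_bigr => i _; rewrite ME; set c := \sum_j _.
    rewrite [(_ + c *: rd) i 0]mxE [(x - _) i 0]mxE [(- _ :
      'cV_n) i 0]mxE [(c *: rd) i 0]mxE.
    by ring.
  by rewrite big_split/= sumrB sdot_S subrr add0r mulr_sumr.
have M0 (x : 'cV[R]_n) : M *m x = 0 -> x = 0.
  move=> Mx0; have := MsE x; rewrite Mx0 big1 => [/esym/eqP|i _];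
    last by rewrite [X in _ * X]mxE mulr0.
  rewrite mulf_eq0 (negbTE ss0) orbF => /eqP sx.
  (* A kernel vector is fixed by [S], which strictly contracts the complement of [rd]; hence it is
     zero. *)
  have Sx : S *m x = x.
    by move: Mx0; rewrite ME sx scale0r addr0 => /eqP;
      rewrite subr_eq0 => /eqP <-.
  have := normalized_adj_contraction sx; rewrite Sx.
  rewrite -subr_ge0 -{2}[\sum_i _]mul1r -mulrBl.
  have l2 : lam ^+ 2 - 1 < 0.
    by rewrite subr_lt0 expr_lt1// second_eigenvalue_ge0.
  rewrite nmulr_rge0// => xle.
  have /eqP : \sum_i x i 0 ^+ 2 = 0.
    by apply/eqP; rewrite eq_le xle sumr_ge0// => i _; rewrite sqr_ge0.
  rewrite psumr_eq0 => [/allP x0|i _]; last by rewrite sqr_ge0.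
  apply/colP => i; rewrite [RHS]mxE; apply/eqP.
  by have := x0 i (mem_index_enum _); rewrite /= sqrf_eq0.
have symM : M^T = M.
  by rewrite /M !linearD linearN/= normalized_adj_sym trmx1 trmx_mul trmxK.
have Mu : M \in unitmx.
  rewrite -row_free_unit -kermx_eq0; apply/rowV0P => v /sub_kermxP vM.
  apply: trmx_inj; rewrite trmx0; apply: M0.
  by rewrite -symM -trmx_mul vM trmx0.
have My : M *m (invmx M *m q) = q by rewrite mulKVmx.
have sy : \sum_i rd i 0 * (invmx M *m q) i 0 = 0.
  apply/eqP; have /eqP := MsE (invmx M *m q).
  by rewrite My sq eq_sym mulf_eq0 (negbTE ss0) orbF.
exists (invmx M *m q) => //.
by move: My; rewrite ME sy scale0r addr0.
Qed.

(** With y = diag(d)^(1/2) psi, the left side is the squared norm of y on [U], and the last sum is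
    that of diag(d)^(-1/2) q. The condition on [k] and [U] says that the first [k] terms of the
    Neumann series vanish on [U]; for a graph it will follow from distances. *)
Lemma green_decay (q : 'I_n -> R) : \sum_v q v = 0 ->
  exists2 psi : 'I_n -> R,
    forall v, d 0 v * psi v - \sum_u W v u * psi u = q v &
    forall (k : nat) (U : {set 'I_n}),
      (forall j v, (j < k)%N -> v \in U ->
         iter j (mulmx S) (\col_u (q u / rd u 0)) v 0 = 0) ->
      \sum_(v in U) d 0 v * psi v ^+ 2 <=
      (lam ^+ k / (1 - lam)) ^+ 2 * \sum_v q v ^+ 2 / d 0 v.
Proof.
move=> sq; pose q' : 'cV[R]_n := \col_u (q u / rd u 0).
have sq' : \sum_i rd i 0 * q' i 0 = 0.
  by rewrite -[RHS]sq; apply: eq_bigr => i _; rewrite [q' i 0]mxE mulrC divfK.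
have [y sy yq] := normalized_resolvent sq'.
have lam0 := second_eigenvalue_ge0.
have lam' : 0 < 1 - lam by rewrite subr_gt0.
have iter_le k : \sum_i rd i 0 * (iter k (mulmx S) y) i 0 = 0 /\
    \sum_i (iter k (mulmx S) y) i 0 ^+ 2 <= (lam ^+ k) ^+ 2 * \sum_i y i 0 ^+ 2.
  elim: k => [|k [IH1 IH2]]; first by rewrite expr0 expr1n mul1r.
  rewrite iterS; split; first by rewrite sdot_S.
  rewrite (le_trans (normalized_adj_contraction IH1))//.
  by rewrite (exprS _ k) exprMn -[leRHS]mulrA ler_wpM2l// sqr_ge0.
(* The reverse triangle inequality for y - S y = q', with |S y| <= lam |y|. *)
have y_bound : \sum_i y i 0 ^+ 2 <= \sum_i q' i 0 ^+ 2 / (1 - lam) ^+ 2.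
  rewrite -mulr_suml ler_pdivlMr ?exprn_gt0// mulrC -yq sum_sqr_sub_ge//.
    by rewrite lam0.
  exact: normalized_adj_contraction.
exists (fun v => y v 0 / rd v 0) => [v|k U q0].
  have -> : q v = rd v 0 * (y - S *m y) v 0.
    by rewrite yq [q' v 0]mxE mulrC divfK.
  rewrite [(y - _) v 0]mxE [(- (S *m y)) v 0]mxE [(S *m y) v 0]mxE mulrBr -sqr_rd mulr_sumr; congr (_ - _).
    by field.
  apply: eq_bigr => u _; rewrite [S v u]mxE.
  by field; rewrite !rd_neq0.
(* Telescoping: S^j y - S^(j+1) y = S^j q' vanishes on [U] for j < k, so y agrees there with S^k
   y. *)
have y_iter j v : (j <= k)%N -> v \in U -> y v 0 = iter j (mulmx S) y v 0.
  move=> + vU; elim: j => [//|j IH] jk.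
  have iterB a b : iter j (mulmx S) (a - b) =
    iter j (mulmx S) a - iter j (mulmx S) b.
    by elim: (j) => [//|i IHi]; rewrite !iterS IHi mulmxBr.
  have := q0 j v jk vU; rewrite -/q' -yq iterB -iterSr mxE => /eqP.
  by rewrite [X in _ + X]mxE subr_eq0 => /eqP <-; exact/IH/ltnW.
apply: (@le_trans _ _ (\sum_v (iter k (mulmx S) y) v 0 ^+ 2)).
  rewrite [leRHS](bigID (mem U))/= -[leLHS]addr0 lerD//.
    apply: ler_sum => v vU; rewrite -(y_iter k)//.
    have -> : d 0 v * (y v 0 / rd v 0) ^+ 2 = y v 0 ^+ 2.
      by rewrite -sqr_rd; field.
    exact: lexx.
  by apply: sumr_ge0 => i _; rewrite sqr_ge0.
have [_ /le_trans->//] := iter_le k.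
rewrite [(lam ^+ k / _) ^+ 2]exprMn -[leRHS]mulrA ler_wpM2l ?sqr_ge0//.
rewrite (le_trans y_bound)//.
rewrite -mulr_suml mulrC exprVn ler_wpM2l ?invr_ge0 ?sqr_ge0// ler_sum// => i _.
by rewrite [q' i 0]mxE exprMn exprVn -sqr_rd.
Qed.

End ReversibleChain.

(** * Sensitivity of the optimal flow *)

Section StronglyConvex.
Variables (R : realType) (g : R -> R) (mu : R).
Local Open Scope classical_set_scope.
Hypothesis mu_gt0 : 0 < mu.
Hypothesis gconv : forall x y t : R, 0 <= t <= 1 ->
  g (t * x + (1 - t) * y) <=
    t * g x + (1 - t) * g y - mu / 2 * t * (1 - t) * (x - y) ^+ 2.
Hypothesis dg : forall x : R, derivable g x 1.

(** Strong convexity bounds the difference quotient of [p] at 0 by g y - g x - mu/2 (1 - t)(y -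
    x)^2; let t tend to 0 from the right. *)
Lemma strongly_convex_gradient (x y : R) :
  (g^`()%classic) x * (y - x) + mu / 2 * (y - x) ^+ 2 <= g y - g x.
Proof.
pose p (t : R) := g (x + t * (y - x)).
have dp : is_derive (0 : R) (1 : R) p ((g^`()%classic) x * (y - x)).
  have -> : p = g \o (fun t => x + t * (y - x)) by [].
  apply: is_derive1_comp.
    by rewrite mul0r addr0 derive1E; apply/derivableP.
  by apply: is_derive_eq; rewrite add0r mul1r scaler0 add0r; exact: mulr1.
have /cvg_dnbhs_at_right pcvg :
    h^-1 *: (p (h *: 1 + 0) - p 0) @[h --> (0 : R)^'] -->
      (g^`()%classic) x * (y - x).
  by have [+ <-] := dp.
rewrite -lerBrDr.
apply: (@ler_cvg_to _ (at_right (0 : R)) _ _ _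
   (fun t : R => g y - g x - mu / 2 * (1 - t) * (y - x) ^+ 2)
   _ _ pcvg).
  apply: cvg_at_right_filter; apply: cvgB; first exact: cvg_cst.
  apply: cvgMr_tmp; rewrite -[X in _ --> X]mulr1; apply: cvgMl_tmp.
  rewrite -[X in _ --> X]subr0; apply: cvgB; first exact: cvg_cst.
  exact: cvg_id.
near=> t.
have t0 : 0 < t by near: t; exact: nbhs_right_gt.
have t1 : t <= 1 by near: t; exact: nbhs_right_le.
rewrite /GRing.scale/= ler_pdivrMl// /p mul0r !addr0 mulr1.
have /(gconv y x) : 0 <= t <= 1 by rewrite ltW.
have -> : t * y + (1 - t) * x = x + t * (y - x) by ring.
by move=> H; rewrite -subr_ge0; move: H; rewrite -subr_ge0; congr (0 <= _);
  ring.
Unshelve. all: by end_near. Qed.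

Lemma strongly_convex_monotone (x y : R) :
  mu * (y - x) ^+ 2 <= ((g^`()%classic) y - (g^`()%classic) x) * (y - x).
Proof.
have := lerD (strongly_convex_gradient x y) (strongly_convex_gradient y x).
by rewrite -subr_ge0 => H; rewrite -subr_ge0; move: H; congr (0 <= _); field.
Qed.

(** Strong monotonicity of g' bounds its difference quotients below by [mu]. Multiplying by h^2
    treats both signs of h at once. *)
Lemma strongly_convex_derive2_ge (x : R) : derivable (g^`()%classic) x 1 ->
  mu <= (g^`(2)%classic) x.
Proof.
move=> ddg; rewrite derive1nS derive1n1 derive1E; apply: limr_ge => //.
near=> h; have h0 : h != 0 by near: h; exact: nbhs_dnbhs_neq.
rewrite /GRing.scale/= mulr1.
have h2 : 0 < h ^+ 2 by rewrite exprn_even_gt0.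
rewrite -(ler_pM2r h2).
have := strongly_convex_monotone x (h + x); rewrite addrK => /le_trans; apply.
by rewrite le_eqVlt; apply/orP; left; apply/eqP; field.
Unshelve. all: by end_near. Qed.

Lemma strongly_convex_coercive : exists K :
  R, forall y, mu / 4 * y ^+ 2 - K <= g y.
Proof.
(* Half of the quadratic term mu/2 y^2 absorbs g'(0) y; completing the square costs g'(0)^2 / mu. *)
exists (((g^`()%classic) 0) ^+ 2 / mu - g 0) => y.
have := strongly_convex_gradient 0 y; rewrite subr0 -lerBlDr opprK addrC.
apply: le_trans; rewrite -subr_ge0.
have -> : g 0 + ((g^`()%classic) 0 * y + mu / 2 * y ^+ 2) -
   (mu / 4 * y ^+ 2 - ((g^`()%classic) 0 ^+ 2 / mu - g 0)) =
   (mu / 2 * y + (g^`()%classic) 0) ^+ 2 / mu by field; rewrite gt_eqF.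
by rewrite divr_ge0 ?sqr_ge0// ltW.
Qed.

Lemma derivable_continuous1 : continuous g.
Proof. by move=> x; apply/differentiable_continuous/derivable1_diffP. Qed.

End StronglyConvex.

(** * Existence and differentiability of the optimal flow *)

Section Flow.
Variables (R : realType) (n m : nat) (G : digraph n m) (f : 'I_m -> R -> R).
Hypothesis fconv : forall e, strongly_convex (f e).
Hypothesis fC2 : forall e, twice_continuously_differentiable (f e).
Local Open Scope classical_set_scope.
Local Notation A := (incidence R G).
Local Notation df e := ((f e)^`()%classic).
Local Notation ddf e := ((f e)^`(2)%classic).

Let fD e x : derivable (f e) x 1. Proof. by have [] := fC2 e. Qed.
Let fDD e x : derivable (df e) x 1. Proof. by have [] := fC2 e. Qed.

Lemma derive2_gt0 e x : 0 < ddf e x.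
Proof.
have [mu mu0 muP] := fconv e.
by rewrite (lt_le_trans mu0)// (strongly_convex_derive2_ge muP).
Qed.

Lemma sublevel_bounded (C : R) : exists M : 'I_m -> R,
  forall x, total_cost f x <= C -> forall e, `|x e 0| <= M e.
Proof.
have /choice[mu muP] e :
  exists mu, 0 < mu /\ exists K, forall y, mu / 4 * y ^+ 2 - K <= f e y.
  have [mu mu0 muP] := fconv e; exists mu; split => //.
  exact: (strongly_convex_coercive mu0 muP).
have {muP}[mu0 /choice[K KP]] := all_and2 muP.
(* The costs of the other edges are bounded below by -K i, which leaves mu e / 4 * x_e^2 <= C + sum
   K for the edge [e]. *)
exists (fun e => Num.sqrt ((C + \sum_e K e) / (mu e / 4))) => x xC e.
rewrite -sqrtr_sqr ler_wsqrtr// ler_pdivlMr ?divr_gt0// mulrC -lerBlDr.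
apply: le_trans xC; rewrite /total_cost (bigD1 e)//= [leRHS](bigD1 e)//=.
rewrite opprD addrA lerD// lerNl -sumrN ler_sum// => i _.
rewrite lerNl; apply: le_trans (KP i _); rewrite lerDr mulr_ge0 ?sqr_ge0//.
by rewrite divr_ge0// ltW.
Qed.

(** Row vectors are the form to which compactness of boxes and the extreme value theorem apply in
    [opt_flowP]. *)
Lemma continuous_total_cost : continuous (fun v : 'rV[R]_m => total_cost f v^T).
Proof.
apply: continuous_big => [|e _ v]; first exact: add_continuous.
rewrite /continuous_at mxE; under eq_fun do rewrite mxE.
apply: (@continuous_comp _ _ _ (fun v : 'rV[R]_m => v 0 e));
  first exact: coord_continuous.
exact: derivable_continuous1.
Qed.

Lemma closed_feasible (b : 'cV[R]_n) : closed [set v : 'rV[R]_m | A *m v^T = b].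
Proof.
rewrite [X in closed X](_ : _ = \bigcap_(i in [set: 'I_n])
    (fun v : 'rV[R]_m => \sum_e A i e * v 0 e) @^-1` [set x | x = b i 0]).
  apply: closed_bigI => i _; apply: preimage_closed; last exact: closed_eq.
  move=> v _.
  apply: continuous_big => [|e _ u]; first exact: add_continuous.
  by apply: cvgMl_tmp; [exact: nbhs_filter|exact: (@coord_continuous R 1 m 0 e u)].
have AE (v : 'rV[R]_m) i : (A *m v^T) i 0 = \sum_e A i e * v 0 e.
  by rewrite mxE; apply: eq_bigr => e _; rewrite [v^T e 0]mxE.
apply/seteqP; split => [v /= vb i _|v vb].
  by rewrite /= -vb AE.
by apply/colP => i; rewrite AE; exact: vb.
Qed.

Lemma opt_flowP (b : 'cV[R]_n) : im_incidence G b ->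
  is_opt_flow G f b (opt_flow G f b).
Proof.
move=> [x0 _ x0b].
suff [x xP] : exists x, is_opt_flow G f b x.
  exact: (@xgetPex _ 0 [set x | is_opt_flow G f b x] (ex_intro _ x xP)).
have [M MP] := sublevel_bounded (total_cost f x0).
(* A feasible flow outside this box costs more than [x0], so a minimizer over the compact set [B] is
   a global one. *)
pose B := [set v : 'rV[R]_m | forall i, `[- M i, M i]%classic (v 0 i)] `&`
  [set v : 'rV[R]_m | A *m v^T = b].
have inB x : A *m x = b -> total_cost f x <= total_cost f x0 -> B x^T.
  move=> xb xx0; split; last by rewrite /= trmxK.
  by move=> i /=; rewrite in_itv/= mxE -ler_norml MP.
have cB : compact B.
  apply: compact_closedI; last exact: closed_feasible.
  by apply: (@rV_compact _ _ (fun i => `[- M i, M i]%classic)) => i;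
    exact: segment_compact.
have B0 : B !=set0 by exists x0^T; exact: inB.
have [c cB' cP] := EVT_min_rV B0 cB (continuous_subspaceT continuous_total_cost).
move: cB'; rewrite inE => -[_ cb].
exists c^T; split => // y yb;
  have [yx0|/ltW yx0] := leP (total_cost f y) (total_cost f x0).
  by have := cP y^T; rewrite trmxK; apply; rewrite inE; exact: inB.
apply: le_trans yx0; have := cP x0^T; rewrite trmxK; apply.
by rewrite inE; exact: inB.
Qed.

(** A circulation [c] can be added to [x] in either direction without changing the demand, so the
    cost along [c] is minimal at 0. *)
Lemma opt_flow_stationary (b : 'cV[R]_n) (x c : 'cV[R]_m) :
  is_opt_flow G f b x ->
  A *m c = 0 -> \sum_e df e (x e 0) * c e 0 = 0.
Proof.
move=> [xb xopt] c0.
pose p (t : R) := \sum_e f e (x e 0 + t * c e 0).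
have dp t : is_derive t (1 : R) p (\sum_e df e (x e 0 + t * c e 0) * c e 0).
  have -> : p = \sum_e (f e \o (fun t => x e 0 + t * c e 0)).
    by apply/funext => s; rewrite fct_sumE.
  apply: is_derive_sum => e; apply: is_derive1_comp.
    by rewrite derive1E; exact/derivableP.
  by apply: is_derive_eq; rewrite ?add0r ?mul1r scaler0 add0r; exact: mulr1.
have dp0 : is_derive (0 : R) (1 : R) p 0.
  apply: (@derive1_at_min _ _ (-1) 1).
  - lra.
  - by move=> t _; have [] := dp t.
  - by rewrite in_itv/=; lra.
  - move=> t _; have := xopt (x + t *: c).
    rewrite mulmxDr -scalemxAr c0 scaler0 addr0 => /(_ xb).
    rewrite /total_cost /p; congr (_ <= _); apply: eq_bigr => e _.
      by rewrite mul0r addr0.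
    by rewrite !mxE.
have [_ E1] := dp 0; have [_ E2] := dp0; apply: etrans E2; rewrite E1.
by apply: eq_bigr => e _; rewrite mul0r addr0.
Qed.

(* Testing the stationarity conditions at [x] and [y] against the circulation
   [y - x - h], strong monotonicity of the [f_e'] leaves only the linearization
   error of [f_e'] at [x]. *)
Lemma opt_flow_perturbation (mu : 'I_m ->
  R) (b b' : 'cV[R]_n) (x y h : 'cV[R]_m) :
  (forall e, 0 < mu e) ->
  (forall e s t, mu e * (t - s) ^+ 2 <=
     (df e t - df e s) * (t - s)) ->
  is_opt_flow G f b x -> is_opt_flow G f b' y -> A *m h = b' - b ->
  (forall c : 'cV[R]_m, A *m c = 0 ->
     \sum_e ddf e (x e 0) * h e 0 * c e 0 = 0) ->
  \sum_e mu e * (y e 0 - x e 0 - h e 0) ^+ 2 <=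
  \sum_e (df e (x e 0 + h e 0) - df e (x e 0)
          - ddf e (x e 0) * h e 0) ^+ 2 / mu e.
Proof.
move=> mu0 mono xopt yopt hb hstat; pose c := y - x - h.
have cE e : y e 0 - x e 0 - h e 0 = c e 0 by rewrite !mxE.
have Ac : A *m c = 0.
  by rewrite !mulmxBr hb (proj1 xopt) (proj1 yopt) subrr.
have := opt_flow_stationary xopt Ac; have := opt_flow_stationary yopt Ac.
have := hstat c Ac; move=> h0 y0 x0.
(* By the three stationarity conditions [E] sums to zero; adding it reduces the claim to one
   inequality per edge. *)
pose E e := 2 * (df e (y e 0) * c e 0 - df e (x e 0) * c e 0
   - ddf e (x e 0) * h e 0 * c e 0).
rewrite -[leRHS]add0r -[X in X + _](_ : \sum_e E e = 0); last first.
  by rewrite -mulr_sumr !sumrB h0 y0 x0 !subr0 mulr0.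
rewrite -big_split/= ler_sum// => e _; rewrite /E cE.
have := mono e (x e 0 + h e 0) (y e 0); rewrite opprD addrA cE.
set r := (X in X ^+ 2 / _); set u := df e (y e 0).
set v := df e (x e 0 + h e 0) in r *.
set w := df e (x e 0) in r *.
set z := ddf e (x e 0) * h e 0 in r *.
(* Monotonicity gives E >= 2 mu c^2 + 2 r c; what remains is the square (r + mu c)^2 / mu. *)
have := sqr_ge0 (r + mu e * c e 0); move=> /(divr_ge0)/(_ (ltW (mu0 e))).
have -> : (r + mu e * c e 0) ^+ 2 / mu e =
   r ^+ 2 / mu e + 2 * r * c e 0 + mu e * c e 0 ^+ 2.
  by field; rewrite gt_eqF.
move: (r ^+ 2 / mu e) => q; rewrite /r; lra.
Qed.

(** The hypotheses on [h] are the linearized optimality conditions. [opt_flow_perturbation], applied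
    to the step t h, bounds the error X t - x - t h by the linearization errors of the f_e', which
    are o(t). *)
Lemma nablaE (b : 'cV[R]_n) (e0 : 'I_m) (h : 'cV[R]_m) :
  im_incidence G b -> A *m h =
    basis_vec R (src G e0) - basis_vec R (dst G e0) ->
  (forall c : 'cV[R]_m, A *m c = 0 ->
     \sum_e ddf e (opt_flow G f b e 0) * h e 0 * c e 0 = 0) ->
  nabla G f e0 b = h.
Proof.
move=> [x0 _ x0b] hb hstat; set x := opt_flow G f b in hstat *.
pose X t := opt_flow G f (b + t *: (basis_vec R (src G e0) - basis_vec R (dst G e0))).
have Xopt t : is_opt_flow G f
    (b + t *: (basis_vec R (src G e0) - basis_vec R (dst G e0))) (X t).
  apply: opt_flowP => //; exists (x0 + t *: h) => //.
  by rewrite mulmxDr -scalemxAr hb x0b.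
have X0 : X 0 = x by rewrite /X scale0r addr0.
have xopt : is_opt_flow G f b x by rewrite -X0; have := Xopt 0;
  rewrite scale0r addr0.
have /choice[mu muP] e : exists mu, 0 < mu /\ (forall s t, mu * (t - s) ^+ 2 <=
     (df e t - df e s) * (t - s)).
  have [mu mu0 muP] := fconv e; exists mu; split => //.
  exact: (strongly_convex_monotone muP).
have {muP}[mu0 mono] := all_and2 muP.
pose r e (t : R) := df e (x e 0 + t * h e 0) - df e (x e 0)
          - ddf e (x e 0) * (t * h e 0).
have energy t : \sum_e mu e * (X t e 0 - x e 0 - t * h e 0) ^+ 2 <=
    \sum_e r e t ^+ 2 / mu e.
  have := @opt_flow_perturbation mu _ _ x (X t) (t *: h) mu0 mono xopt (Xopt t).
  rewrite -scalemxAr hb (addrC b) addrK => /(_ erefl) H.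
  
  have -> : \sum_e mu e * (X t e 0 - x e 0 - t * h e 0) ^+ 2 =
    \sum_e mu e * (X t e 0 - x e 0 - (t *: h) e 0) ^+ 2.
    by apply: eq_bigr => e _; rewrite [(t *: h) e 0]mxE.
  apply: le_trans (H _) _ => [c Ac|]; last first.
    by apply: ler_sum => e _; rewrite [(t *: h) e 0]mxE.
  have /(congr1 ( *%R t)) := hstat c Ac; rewrite mulr0 mulr_sumr => E.
  apply: etrans E; apply: eq_bigr => e _.
  by rewrite [(t *: h) e 0]mxE; ring.
have r0 e : t^-1 * r e t @[t --> (0 : R)^'] --> (0 : R).
  have dr : is_derive (0 : R) (1 : R) (fun t => df e (x e 0 + t * h e 0))
      (ddf e (x e 0) * h e 0).
    have -> : (fun t => df e (x e 0 + t * h e 0)) =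
       df e \o (fun t => x e 0 + t * h e 0) by [].
    apply: is_derive1_comp.
      by rewrite mul0r addr0 derive1nS derive1n1 derive1E; apply/derivableP.
    by apply: is_derive_eq; rewrite ?add0r ?mul1r scaler0 add0r; exact: mulr1.
  have rcvg : t^-1 *: (df e (x e 0 + (t *: (1 : R) + 0) * h e 0) -
      df e (x e 0 + 0 * h e 0)) @[t --> (0 : R)^'] -->
      ddf e (x e 0) * h e 0.
    by have [+ <-] := dr.
  apply/cvgrPdist_lt => eps eps0.
  move/cvgrPdist_lt : rcvg => /(_ eps eps0) rcvg; near=> t.
  have t0 : t != 0 by near: t; exact: nbhs_dnbhs_neq.
  have -> : 0 - t^-1 * r e t = ddf e (x e 0) * h e 0 -
      t^-1 *: (df e (x e 0 + (t *: (1 : R) + 0) * h e 0) -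
      df e (x e 0 + 0 * h e 0)).
    by rewrite [t *: 1]mulr1 addr0 mul0r addr0 /r /GRing.scale/=; field.
  by near: t; exact: rcvg.
have G0 : \sum_e (t^-1 * r e t) ^+ 2 / mu e @[t --> (0 : R)^'] --> (0 : R).
  rewrite [X in _ --> X](_ : 0 = \sum_e 0 * 0 / mu e); last first.
    by rewrite big1// => e _; rewrite mul0r mul0r.
  apply: cvg_big => [|e _]; first exact: add_continuous.
  by apply: cvgMr_tmp; apply: cvgM; exact: r0.
(* The error at one edge is a single nonnegative term of [energy]; dividing by t^2 leaves a sum that
   tends to 0 by [G0]. *)
have Xcvg e : t^-1 *: (X (t *: 1 + 0) e 0 - X 0 e 0) @[t --> (0 : R)^'] -->
  h e 0.
  apply/cvgrPdist_lt => eps eps0.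
  have eps2 : 0 < mu e * eps ^+ 2 by rewrite mulr_gt0// exprn_gt0.
  have /cvgrPdist_lt/(_ _ eps2) Gnear := G0.
  near=> t; have t0 : t != 0 by near: t; exact: nbhs_dnbhs_neq.
  have Gt : \sum_e (t^-1 * r e t) ^+ 2 / mu e < mu e * eps ^+ 2.
    have : `|0 - \sum_e (t^-1 * r e t) ^+ 2 / mu e| < mu e * eps ^+ 2.
      by near: t; exact: Gnear.
    by rewrite sub0r normrN; apply: le_lt_trans; exact: ler_norm.
  rewrite X0 distrC [t *: 1]mulr1 addr0.
  have -> : t^-1 *: (X t e 0 - x e 0) - h e 0 =
    t^-1 * (X t e 0 - x e 0 - t * h e 0).
    by rewrite /GRing.scale/=; field.
  rewrite -(ltr_pXn2r (_ : (0 < 2)%N)) ?nnegrE ?normr_ge0 ?ltW//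
    real_normK ?num_real//.
  rewrite -(ltr_pM2l (mu0 e)) (le_lt_trans _ Gt)//.
  have -> : \sum_e (t^-1 * r e t) ^+ 2 / mu e =
    t^-1 ^+ 2 * \sum_e r e t ^+ 2 / mu e.
    by rewrite mulr_sumr; apply: eq_bigr => i _; rewrite exprMn -mulrA.
  rewrite exprMn mulrCA ler_wpM2l ?sqr_ge0// (le_trans _ (energy t))//.
  rewrite [leRHS](bigD1 e)//= lerDl sumr_ge0// => i _.
  by rewrite mulr_ge0 ?sqr_ge0// ltW.
have Xder e j : is_derive (0 : R) (1 : R) (fun t => X t e j) (h e j).
  rewrite (ord1 j); apply: DeriveDef; first by apply/cvg_ex; exists (h e 0);
    exact: Xcvg.
  by apply: cvg_lim => //; exact: Xcvg.
rewrite /nabla -/X derive1E derive_mx; last first.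
  by apply/derivable_mxP => i j; have [] := Xder i j.
by apply/matrixP => i j; rewrite mxE; have [_ ->] := Xder i j.
Unshelve. all: by end_near. Qed.

End Flow.

(** * Walks and edge counts *)

Section GraphFacts.
Variables (n m : nat) (G : digraph n m).

Lemma joinsC e u v : joins G e u v = joins G e v u.
Proof. by rewrite /joins orbC. Qed.

Lemma joins_inj e e' u v : joins G e u v -> joins G e' u v -> e = e'.
Proof.
move=> /orP[]/andP[/eqP su /eqP dv] /orP[]/andP[/eqP su' /eqP dv'].
- by apply: (no_parallel (d := G)); rewrite (su, dv) (su', dv').
- by case: (no_antiparallel (d := G) (e := e) (e' := e'));
  rewrite su dv su' dv'.
- by case: (no_antiparallel (d := G) (e := e) (e' := e'));
  rewrite su dv su' dv'.
- by apply: (no_parallel (d := G)); rewrite (su, dv) (su', dv').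
Qed.

Lemma joins_src_dst e : joins G e (src G e) (dst G e).
Proof. by rewrite /joins !eqxx. Qed.

Lemma sum_joins (V : nmodType) e v (F : 'I_n -> V) :
  \sum_(u | joins G e v u) F u =
  if v == src G e then F (dst G e) else if v == dst G e then F (src G e) else 0.
Proof.
have sd := no_self_edge G e.
have [->|vs] := eqVneq v (src G e).
  rewrite (big_pred1 (dst G e)) // => u.
  by rewrite /joins eqxx/= [dst G e == src G e]eq_sym (negbTE sd) andbF orbF eq_sym.
have [->|vd] := eqVneq v (dst G e).
  rewrite (big_pred1 (src G e)) // => u.
  by rewrite /joins eqxx/= (negbTE sd) andbT eq_sym.
rewrite big_pred0 // => u.
by rewrite /joins eq_sym (negbTE vs) [dst G e == v]eq_sym (negbTE vd) andbF.
Qed.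

Lemma bigminn_leq (I : eqType) (r : seq I) (P : pred I) (F : I -> nat) k i :
  i \in r -> P i -> (\big[minn/k]_(j <- r | P j) F j <= F i)%N.
Proof.
elim: r => [//|j r IH]; rewrite inE big_cons => /orP[/eqP<- ->|/IH{}IH Pi].
  exact: geq_minl.
by case: ifP => _; [exact: leq_trans (geq_minr _ _) (IH Pi)|exact: IH].
Qed.

Lemma bigminn_leq_id (I : Type) (r : seq I) (P : pred I) (F : I -> nat) k :
  (\big[minn/k]_(j <- r | P j) F j <= k)%N.
Proof.
elim/big_rec: _ => // i x _; apply: leq_trans; exact: geq_minr.
Qed.

Lemma set_dist_walk (U Z : {set 'I_n}) u z k :
  u \in U -> z \in Z -> walk G k u z -> (set_dist G U Z <= k)%N.
Proof.
move=> uU zZ uz; have [nk|kn] := leqP n k.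
  (* [dist] only inspects walks shorter than [n]; for longer ones the default value [n] of the
     minimum gives the bound. *)
  by apply: leq_trans nk; exact: bigminn_leq_id.
apply: leq_trans (bigminn_leq _ _ (mem_index_enum u) uU) _.
apply: leq_trans (bigminn_leq _ _ (mem_index_enum z) zZ) _.
exact: (bigminn_leq (fun k : 'I_n => k :
  nat) n (mem_index_enum (Ordinal kn)) uz).
Qed.

Lemma walk0 u : walk G 0 u u.
Proof. by apply/existsP; exists [tuple]; rewrite /= eqxx. Qed.

Lemma walkS k u v w : adj G u v -> walk G k v w -> walk G k.+1 u w.
Proof.
move=> uv /existsP[p /andP[vp pw]].
by apply/existsP; exists [tuple of v :: p]; rewrite /= uv vp.
Qed.

Lemma connected_adj u : connected_graph G -> (1 < n)%N -> exists v, adj G u v.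
Proof.
move=> Gconn n1.
have [v vu] : exists v, v != u.
  have : (0 < #|[set~ u]|)%N by rewrite cardsC1 card_ord -ltnS prednK// ltnW.
  by rewrite card_gt0 => /set0Pn[v]; rewrite !inE => vu; exists v.
have /connectP[[|w p] /= up vl] := Gconn u v; first by rewrite vl eqxx in vu.
by exists w; have /andP[] := up.
Qed.

(** Send each edge of [F] at [v] to its other endpoint; this is injective since at most one edge
    joins two vertices. *)
Lemma card_incident_le (F : {set 'I_m}) v :
  (#|[set e in F | (v == src G e) || (v == dst G e)]| <=
   #|neighbors G v :&: endpoints G F|)%N.
Proof.
pose opp e := if v == src G e then dst G e else src G e.
set I := [set e in F | _].
have joins_opp e : e \in I -> joins G e v (opp e).
  rewrite !inE /opp => /andP[_]; have [->|_ /eqP->] /= := eqVneq v (src G e).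
    by rewrite joins_src_dst.
  by rewrite joinsC joins_src_dst.
have opp_inj : {in I &, injective opp}.
  move=> e e' eI e'I ee'; apply: (@joins_inj e e' v (opp e));
    first exact: joins_opp.
  by rewrite ee' joins_opp.
rewrite -(card_in_imset opp_inj) subset_leq_card//.
apply/fintype.subsetP => _ /imsetP[e eI ->]; rewrite !inE; apply/andP; split.
  by apply/existsP; exists e; exact: joins_opp.
apply/existsP; exists e; move: eI; rewrite !inE => /andP[-> _] /=.
by rewrite /opp; case: ifP => _; rewrite eqxx ?orbT.
Qed.

(** Use (x - y)^2 <= 2 x^2 + 2 y^2 on each edge, exchange the sums, and count the edges of [F] at
    each vertex. *)
Lemma sum_sqr_edges_le (R : realDomainType) (F : {set 'I_m}) (psi : 'I_n -> R) :
  \sum_(e in F) (psi (src G e) - psi (dst G e)) ^+ 2 <=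
  \sum_(v in endpoints G F) 2 * #|neighbors G v :&: endpoints G F|%:R * psi v ^+ 2.
Proof.
apply: (@le_trans _ _ (\sum_(e in F) \sum_(v in endpoints G F)
   if (v == src G e) || (v == dst G e) then 2 * psi v ^+ 2 else 0)).
  apply: ler_sum => e eF.
  have inF v : (v == src G e) || (v == dst G e) -> v \in endpoints G F.
    by move=> ve; rewrite inE; apply/existsP; exists e; rewrite eF.
  rewrite -big_mkcondr/=.
  rewrite (eq_bigl (fun v => (v == src G e) || (v == dst G e))); last first.
    by move=> v; case ve: (_ || _); rewrite ?andbF ?andbT// inF.
  rewrite (bigD1 (src G e)) ?eqxx//= (big_pred1 (dst G e)); last first.
    move=> v; rewrite -[RHS]/(v == dst G e).
    have [->|vd] := eqVneq v (dst G e);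
      first by rewrite orbT eq_sym no_self_edge.
    by rewrite orbF andbN.
  rewrite -subr_ge0; set x := psi _; set y := psi _.
  have -> : 2 * x ^+ 2 + 2 * y ^+ 2 - (x - y) ^+ 2 = (x + y) ^+ 2 by ring.
  exact: sqr_ge0.
rewrite exchange_big/=; apply: ler_sum => v _.
rewrite -big_mkcondr/= sumr_const -[leLHS]mulr_natl.
rewrite -[leRHS]mulrA [leRHS]mulrCA; apply: ler_wpM2r.
  by rewrite mulr_ge0// sqr_ge0.
rewrite ler_nat; apply: leq_trans (card_incident_le F v).
by rewrite leq_eqVlt; apply/orP; left; apply/eqP/eq_card => e; rewrite !inE.
Qed.

End GraphFacts.

(** * The weighted Laplacian and potential flows *)

Section Weights.
Variables (R : realType) (n m : nat) (G : digraph n m) (f : 'I_m -> R -> R).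
Hypothesis Gconn : connected_graph G.
Hypothesis n_gt1 : (1 < n)%N.
Hypothesis fconv : forall e, strongly_convex (f e).
Hypothesis fC2 : forall e, twice_continuously_differentiable (f e).
Variable b : 'cV[R]_n.
Local Notation A := (incidence R G).
Local Notation W := (weight G f b).
Local Notation d := (wdeg G f b).
Definition conductance e : R := ((f e)^`(2)%classic (opt_flow G f b e 0))^-1.

Lemma conductance_gt0 e : 0 < conductance e.
Proof. by rewrite invr_gt0; exact: derive2_gt0. Qed.

Lemma weight_joins e u v : joins G e u v -> W u v = conductance e.
Proof.
move=> euv; rewrite mxE; case: pickP => [e' /joins_inj/(_ euv)->//|/(_ e)].
by rewrite euv.
Qed.

Lemma weight_nadj u v : ~~ adj G u v -> W u v = 0.
Proof.
move=> nuv; rewrite mxE; case: pickP => // e euv.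
by case/negP: nuv; apply/existsP; exists e.
Qed.

(** The sum has at most one term; unlike the choice of an edge, it can be exchanged with sums over
    vertices. *)
Lemma weightE u v : W u v = \sum_(e | joins G e u v) conductance e.
Proof.
have [/existsP[e euv]|nuv] := boolP (adj G u v).
  rewrite (weight_joins euv) (big_pred1 e)// => e'.
  by apply/idP/eqP => [/joins_inj/(_ euv)|->].
rewrite weight_nadj// big_pred0// => e; apply: contraNF nuv => euv.
by apply/existsP; exists e.
Qed.

Lemma weight_sym u v : W u v = W v u.
Proof. by rewrite !weightE; apply: eq_bigl => e; rewrite joinsC. Qed.

Lemma weight_ge0 u v : 0 <= W u v.
Proof. by rewrite weightE sumr_ge0// => e _; rewrite ltW// conductance_gt0. Qed.

Lemma wdegE v : d 0 v = \sum_u W v u.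
Proof. by rewrite mxE. Qed.

Lemma wdeg_gt0 v : 0 < d 0 v.
Proof.
have [u /existsP[e evu]] := connected_adj v Gconn n_gt1.
rewrite wdegE (bigD1 u)//= (weight_joins evu) ltr_pwDl ?conductance_gt0//.
by apply: sumr_ge0 => w _; exact: weight_ge0.
Qed.

(** Ohm's law: the flow driven by the vertex potentials [psi]. *)
Definition potential_flow (psi : 'I_n -> R) : 'cV[R]_m :=
  \col_e (conductance e * (psi (src G e) - psi (dst G e))).

Lemma incidence_sum (psi : 'I_n -> R) e :
  \sum_v A v e * psi v = psi (src G e) - psi (dst G e).
Proof.
rewrite (bigD1 (src G e))//= (bigD1 (dst G e)) /=;
  last by rewrite eq_sym no_self_edge.
rewrite big1 => [|v /andP[vs vd]];
  last by rewrite mxE (negbTE vs) (negbTE vd) mul0r.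
by rewrite !mxE !eqxx eq_sym (negbTE (no_self_edge G e)) mul1r mulN1r addr0.
Qed.

(** This is the factorization of the Laplacian as A diag(conductance) A^T. *)
Lemma incidence_potential_flow psi v :
  (A *m potential_flow psi) v 0 = d 0 v * psi v - \sum_u W v u * psi u.
Proof.
have -> : d 0 v * psi v - \sum_u W v u * psi u = \sum_u W v u * (psi v - psi u).
  by rewrite wdegE mulr_suml -sumrB; apply: eq_bigr => u _; rewrite mulrBr.
under [RHS]eq_bigr do rewrite weightE mulr_suml big_mkcond/=.
rewrite exchange_big mxE/=; apply: eq_bigr => e _.
rewrite -big_mkcond/= sum_joins !mxE.
have [->|_] := eqVneq v (src G e); first by rewrite mul1r.
have [->|_] := eqVneq v (dst G e); last by rewrite mul0r.
by rewrite mulN1r -mulrN opprB.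
Qed.

(** The second derivatives cancel the conductances and leave A^T psi, which is orthogonal to the
    kernel of A. *)
Lemma potential_flow_orthogonal psi (c : 'cV[R]_m) : A *m c = 0 ->
  \sum_e (f e)^`(2)%classic (opt_flow G f b e 0) * potential_flow psi e 0 * c e 0 = 0.
Proof.
move=> Ac0.
transitivity (\sum_v psi v * (A *m c) v 0); last first.
  by rewrite Ac0 big1// => v _; rewrite [X in _ * X]mxE mulr0.
under [RHS]eq_bigr do rewrite [X in _ * X]mxE mulr_sumr.
rewrite exchange_big/=; apply: eq_bigr => e _.
rewrite mxE mulVKf ?gt_eqF ?derive2_gt0//.
rewrite -incidence_sum mulr_suml; apply: eq_bigr => v _; ring.
Qed.

Lemma nabla_potential (psi : 'I_n -> R) e g : im_incidence G b ->
  (forall v, d 0 v * psi v - \sum_u W v u * psi u =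
    (v == src G e)%:R - (v == dst G e)%:R) ->
  nabla G f e b g 0 = conductance g * (psi (src G g) - psi (dst G g)).
Proof.
move=> bim Lpsi; rewrite (@nablaE _ _ _ _ _ _ fC2 _ _ (potential_flow psi))//.
- by rewrite mxE.
- apply/colP => v; rewrite incidence_potential_flow Lpsi.
  by rewrite 3!mxE [in RHS]mxE eqxx !andbT.
- exact: potential_flow_orthogonal.
Qed.

Lemma laplacian_sym (phi psi : 'I_n -> R) :
  \sum_v (d 0 v * phi v - \sum_u W v u * phi u) * psi v =
  \sum_v phi v * (d 0 v * psi v - \sum_u W v u * psi u).
Proof.
under eq_bigr do rewrite mulrBl mulr_suml.
under [RHS]eq_bigr do rewrite mulrBr mulr_sumr.
rewrite !sumrB; congr (_ - _); first by apply: eq_bigr => v _; ring.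
rewrite exchange_big/=; apply: eq_bigr => v _; apply: eq_bigr => u _.
by rewrite (weight_sym u); ring.
Qed.

(** Finite propagation speed: [S] is supported on the edges, so each application moves the support
    by at most one step. *)
Lemma iter_normalized_adj_walk k (q : 'cV[R]_n) v :
  iter k (mulmx (normalized_adj W d)) q v 0 != 0 ->
  exists2 u, q u 0 != 0 & walk G k v u.
Proof.
elim: k v => [v qv|k IH v]; first by exists v => //; exact: walk0.
rewrite iterS mxE => /eqP/eqP S0.
have [w] : exists w, normalized_adj W d v w * iter k (mulmx (normalized_adj W d)) q w 0 != 0.
  apply/existsP; apply: contraNT S0; rewrite negb_exists => /forallP S0.
  by rewrite big1// => w _; have := S0 w; rewrite negbK => /eqP.
rewrite mulf_eq0 negb_or => /andP[vw /IH[u qu wu]]; exists u => //.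
apply: walkS wu; apply: contraNT vw => /weight_nadj vw.
by rewrite mxE vw mul0r.
Qed.

Lemma lambda_at_le1 : lambda_at G f b <= 1.
Proof.
exact: (second_eigenvalue_le1 weight_sym weight_ge0 wdegE wdeg_gt0 n_gt1).
Qed.

Lemma lambda_at_ge0 : 0 <= lambda_at G f b.
Proof. exact: second_eigenvalue_ge0. Qed.

End Weights.

(** * Decay of potentials with the graph distance *)

Section Decay.
Variables (R : realType) (n m : nat) (G : digraph n m) (f : 'I_m -> R -> R).
Hypothesis Gconn : connected_graph G.
Hypothesis n_gt1 : (1 < n)%N.
Hypothesis fconv : forall e, strongly_convex (f e).
Hypothesis fC2 : forall e, twice_continuously_differentiable (f e).
Hypothesis lambda_lt1 : lambda G f < 1.

(** For [sup] to be an upper bound the set must be bounded, which the stochasticity of [P] ensures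
    with the bound 1. *)
Lemma lambda_at_le b : im_incidence G b -> lambda_at G f b <= lambda G f.
Proof.
move=> bim; apply: sup_upper_bound; last by exists b.
split; first by exists (lambda_at G f b), b.
by exists 1 => _ [b' _ <-]; exact: lambda_at_le1.
Qed.

(** A nonzero value on [U] of the j-th Neumann term would give a walk of length j from [U] to [Z],
    so the terms below the distance vanish on [U]. *)
Lemma flow_green_decay (b : 'cV[R]_n) (q : 'I_n -> R) :
  im_incidence G b -> \sum_v q v = 0 ->
  exists2 psi : 'I_n -> R,
    forall v, wdeg G f b 0 v * psi v - \sum_u weight G f b v u * psi u = q v &
    forall U Z : {set 'I_n}, (forall u, q u != 0 -> u \in Z) ->
      \sum_(v in U) wdeg G f b 0 v * psi v ^+ 2 <=
      (lambda_at G f b ^+ set_dist G U Z / (1 - lambda_at G f b)) ^+ 2 *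
      \sum_v q v ^+ 2 / wdeg G f b 0 v.
Proof.
move=> bim q0.
have [psi Lpsi decay] := green_decay (weight_sym G f b)
  (weight_ge0 G fconv fC2 b) (wdegE G f b) (wdeg_gt0 Gconn n_gt1 fconv fC2 b)
  n_gt1 (le_lt_trans (lambda_at_le bim) lambda_lt1) q0.
exists psi => // U Z qZ; apply: decay => j v jk vU.
apply: contraTeq jk => /iter_normalized_adj_walk[u + vu].
rewrite mxE mulf_eq0 negb_or => /andP[/qZ uZ _]; rewrite -leqNgt.
exact: set_dist_walk vu.
Qed.

(** The demand 0 lies in the image outright, so the Laplacian of its optimal flow is available;
    solving it with right-hand side [b] yields a potential flow that routes [b]. *)
Lemma im_incidence_sum0 (b : 'cV[R]_n) : \sum_v b v 0 = 0 -> im_incidence G b.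
Proof.
move=> b0; have im0 : im_incidence G (0 : 'cV[R]_n) by exists 0 => //;
  rewrite mulmx0.
have [psi Lpsi _] := flow_green_decay im0 b0.
exists (potential_flow G f 0 psi) => //; apply/colP => v.
by rewrite incidence_potential_flow.
Qed.

End Decay.

Lemma min_over_le (R : realType) n (U : {set 'I_n}) (F : 'I_n -> R) v :
  v \in U -> min_over U F <= F v.
Proof.
move=> vU; rewrite /min_over; case: pickP => [v0 _|/(_ v)]; last by rewrite vU.
exact: bigmin_le_cond.
Qed.

Lemma min_over_gt0 (R : realType) n (U : {set 'I_n}) (F : 'I_n -> R) :
  U != finset.set0 -> (forall v, 0 < F v) -> 0 < min_over U F.
Proof.
move=> /finset.set0Pn[u uU] F0; rewrite /min_over; case: pickP => [v0 _|/(_ u)].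
  by apply/bigmin_gtP; split.
by rewrite uU.
Qed.

Lemma endpoints_neq0 n m (G : digraph n m) (F : {set 'I_m}) :
  F != finset.set0 -> endpoints G F != finset.set0.
Proof.
move=> /finset.set0Pn[e eF]; apply/finset.set0Pn; exists (src G e).
by rewrite inE; apply/existsP; exists e; rewrite eF eqxx.
Qed.

Theorem lemma2 (R : realType) (n m : nat) (G : digraph n m)
    (f : 'I_m -> R -> R)
    (Gconn : connected_graph G)
    (fconv : forall e, strongly_convex (f e))
    (fC2 : forall e, twice_continuously_differentiable (f e))
    (lambda_lt1 : lambda G f < 1)
    (b : 'cV[R]_n) (b0 : \sum_v b v 0 = 0)
    (F : {set 'I_m}) (F0 : F != finset.set0) (g : 'I_m) :
  ((Num.sqrt (\sum_(e in F) (nabla G f e b g 0) ^+ 2))%:E <=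
   (Num.sqrt 2)%:E * c_prime G f F g *
   (lambda G f ^+ set_dist G (endpoints G F) (endpoints G (finset.set1 g))
      / (1 - lambda G f))%:E)%E.
Proof.
have n_gt1 : (1 < n)%N.
  rewrite -[n]card_ord; apply/card_gt1P; exists (src G g), (dst G g).
  by split => //; exact: no_self_edge.
have bim := im_incidence_sum0 Gconn n_gt1 fconv fC2 lambda_lt1 b0.
set VF := endpoints G F; set k := set_dist _ _ _.
set w := src G g; set z := dst G g.
have wz : w != z := no_self_edge G g.
have d_gt0 := wdeg_gt0 Gconn n_gt1 fconv fC2 b.
pose delta e v : R := (v == src G e)%:R - (v == dst G e)%:R.
have sum_delta e (h : 'I_n -> R) : \sum_v delta e v * h v =
  h (src G e) - h (dst G e).
  under eq_bigr do rewrite mulrBl !mulr_natl !mulrb.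
  by rewrite sumrB -!big_mkcond !big_pred1_eq.
have delta0 e : \sum_v delta e v = 0.
  by rewrite -[RHS](subrr 1) -(sum_delta e (fun=> 1)); apply: eq_bigr => v _;
    rewrite mulr1.
have [psi Lpsi /(_ VF (endpoints G [set g]%SET)) decay] :=
  flow_green_decay Gconn n_gt1 fconv fC2 lambda_lt1 bim (delta0 g).
set lb := lambda_at G f b in decay; set l := lambda G f in lambda_lt1 *.
have lb_ge0 : 0 <= lb := lambda_at_ge0 _ _ _.
have lbl : lb <= l := lambda_at_le Gconn n_gt1 fconv fC2 bim.
(* Reciprocity: as the Laplacian is symmetric, the potential [psi] of the
   edge [g] serves all [e]. *)
have nablaE e : nabla G f e b g 0 =
  conductance G f b g * (psi (src G e) - psi (dst G e)).
  have [phi Lphi _] := flow_green_decay Gconn n_gt1 fconv fC2 lambda_lt1 bim (delta0 e).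
  rewrite (nabla_potential fconv fC2 g bim Lphi); congr (_ * _).
  rewrite -!sum_delta -/w -/z.
  under [LHS]eq_bigr do rewrite -Lpsi mulrC.
  by rewrite -laplacian_sym; apply: eq_bigr => v _; rewrite Lphi.
have Zdelta v : delta g v != 0 -> v \in endpoints G [set g]%SET.
  apply: contraNT; rewrite inE negb_exists => /forallP/(_ g).
  by rewrite inE eqxx/= negb_or /delta => /andP[/negbTE-> /negbTE->];
    rewrite subrr.
have {Zdelta}decay := decay Zdelta; rewrite -/k in decay.
have sum_q : \sum_v delta g v ^+ 2 / wdeg G f b 0 v =
  (wdeg G f b 0 w)^-1 + (wdeg G f b 0 z)^-1.
  transitivity (\sum_v delta g v * (delta g v / wdeg G f b 0 v)).
    by apply: eq_bigr => v _; rewrite expr2 mulrA.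
  rewrite sum_delta /delta -/w -/z !eqxx (negbTE wz) [z == w]eq_sym (negbTE wz).
  by rewrite subr0 sub0r mulN1r opprK mul1r.
set M := \big[Num.max/0]_(v in VF) Num.sqrt (2 * #|neighbors G v :&: VF|%:R) : R.
set mu := min_over VF (fun v => Num.sqrt (wdeg G f b 0 v)).
set D := Num.min (wdeg G f b 0 w) (wdeg G f b 0 z).
have D_gt0 : 0 < D by rewrite lt_min !d_gt0.
have mu_gt0 : 0 < mu.
  by apply: min_over_gt0 => [|v]; [exact: endpoints_neq0|rewrite sqrtr_gt0].
have M_ge0 : 0 <= M by exact: bigmax_ge_id.
have cg_gt0 := conductance_gt0 G fconv fC2 b g.
have c_atE : c_at G f F g b = conductance G f b g * M / (Num.sqrt D * mu).
  by rewrite /c_at (weight_joins _ _ (joins_src_dst G g)).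
have c_at_ge0 : 0 <= c_at G f F g b.
  by rewrite c_atE divr_ge0// mulr_ge0// ?sqrtr_ge0// ltW.
pose rb := lb ^+ k / (1 - lb).
have lb_lt1 : lb < 1 := le_lt_trans lbl lambda_lt1.
have rb_ge0 : 0 <= rb by rewrite divr_ge0 ?exprn_ge0// subr_ge0 ltW.
(* t^k / (1 - t) is nondecreasing on [0, 1). *)
have rbr : rb <= l ^+ k / (1 - l).
  apply: ler_pM; rewrite ?exprn_ge0 ?invr_ge0 ?subr_ge0 ?(ltW lb_lt1)//.
    by rewrite lerXn2r ?nnegrE// (le_trans lb_ge0).
  by rewrite lef_pV2 ?posrE ?subr_gt0// lerB.
have real_bound : Num.sqrt (\sum_(e in F) (nabla G f e b g 0) ^+ 2) <=
    Num.sqrt 2 * c_at G f F g b * rb.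
  have rhs_ge0 : 0 <= Num.sqrt 2 * c_at G f F g b * rb.
    by rewrite mulr_ge0// mulr_ge0// sqrtr_ge0.
  rewrite -(ler_pXn2r (_ : (0 < 2)%N)) ?nnegrE ?sqrtr_ge0//.
  rewrite sqr_sqrtr; last by apply: sumr_ge0 => e _; rewrite sqr_ge0.
  under eq_bigr do rewrite nablaE exprMn.
  rewrite -mulr_sumr.
  (* The factors follow the order of the estimates: M^2 passes from edges to vertices, 1 / mu^2
     inserts the weighted degrees, rb^2 is the decay, and 2 / D bounds 1 / d_w + 1 / d_z. *)
  apply: (@le_trans _ _ (conductance G f b g ^+ 2 * (M ^+ 2 * (mu ^- 2 * (rb ^+ 2 * (2 / D)))))).
    rewrite ler_wpM2l ?sqr_ge0// (le_trans (sum_sqr_edges_le G F psi))// -/VF.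
    apply: (@le_trans _ _ (M ^+ 2 * \sum_(v in VF) psi v ^+ 2)).
      rewrite mulr_sumr ler_sum// => v vVF; rewrite ler_wpM2r ?sqr_ge0//.
      rewrite -[leLHS]sqr_sqrtr ?mulr_ge0// lerXn2r ?nnegrE ?sqrtr_ge0//.
      exact: (le_bigmax_cond _ (fun v =>
        Num.sqrt (2 * #|neighbors G v :&: VF|%:R))).
    rewrite ler_wpM2l ?sqr_ge0//.
    apply: (@le_trans _ _ (mu ^- 2 * \sum_(v in VF) wdeg G f b 0 v * psi v ^+ 2)).
      rewrite mulr_sumr ler_sum// => v vVF; rewrite mulrA ler_peMl ?sqr_ge0//.
      rewrite mulrC ler_pdivlMr ?exprn_gt0// mul1r.
      rewrite -[leRHS]sqr_sqrtr ?(ltW (d_gt0 _))//.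
      rewrite lerXn2r ?nnegrE ?sqrtr_ge0 ?(ltW mu_gt0)//.
      exact: (min_over_le (fun v => Num.sqrt (wdeg G f b 0 v)) vVF).
    rewrite ler_wpM2l ?invr_ge0 ?sqr_ge0// (le_trans decay)//.
    rewrite ler_wpM2l ?sqr_ge0// sum_q mulr_natl mulr2n.
    by rewrite lerD// lef_pV2 ?posrE// ge_min lexx ?orbT.
  rewrite c_atE; move: (rb) => r;
    rewrite !(exprMn, exprVn) !sqr_sqrtr ?(ltW D_gt0)//.
  rewrite le_eqVlt; apply/orP; left; apply/eqP; field.
  by rewrite !gt_eqF// -invr_gt0.
(* First lambda(b) is replaced by lambda, then [c_at] by its supremum; the latter takes place in the
   extended reals because [c_prime] may be infinite. *)
apply: (@le_trans _ _ (Num.sqrt 2 * c_at G f F g b * (l ^+ k / (1 - l)))%:E).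
  by rewrite lee_fin (le_trans real_bound)// ler_wpM2l// mulr_ge0// sqrtr_ge0.
rewrite !EFinM; apply: lee_wpmul2r.
  by rewrite -EFinM lee_fin (le_trans rb_ge0).
apply: lee_wpmul2l; first by rewrite lee_fin sqrtr_ge0.
by apply: ereal_sup_ubound; exists b.
Qed.
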